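(* Let $\mathbb{K}/\mathbb{Q}$ be a cyclic extension of degree $n$ with Galois group $G=\operatorname{Gal}(\mathbb{K}/\mathbb{Q})$, let $\theta$ be a generator of $G$, and let $\sigma=(\sigma_1,\dots,\sigma_n)$ be the Minkowski embedding of $\mathbb{K}$ with the embeddings ordered so that $\sigma_k=\theta^{n-k+1}$ for $1\le k\le n$. Let $M$ be a $\mathbb{Z}$-submodule of $\mathbb{K}$ of rank $n$. Then $\Lambda_M=\sigma(M)$ is cyclic if and only if $M$ is $G$-stable.
   Context: The number field $\mathbb{K}$ is regarded as a subfield of $\mathbb{C}$; since $\mathbb{K}/\mathbb{Q}$ is Galois, its $n$ embeddings into $\mathbb{C}$ are identified with the elements of $G$. The Minkowski embedding is $\sigma:\mathbb{K}\to\mathbb{C}^n$, $\sigma(x)=(\sigma_1(x),\dots,\sigma_n(x))$, whose image lies in the real Euclidean space $K_{\mathbb{R}}=\mathbb{K}\otimes_{\mathbb{Q}}\mathbb{R}\subset\mathbb{C}^n$ of real dimension $n$. A $\mathbb{Z}$-submodule $M$ of $\mathbb{K}$ of rank $n$ is a subgroup of $\mathbb{K}$ generated by $n$ $\mathbb{Z}$-linearly independent elements; then $\Lambda_M=\sigma(M)$ is a full-rank lattice in $K_{\mathbb{R}}$. The shift operator is $\rho(c_1,\dots,c_n)=(c_n,c_1,\dots,c_{n-1})$ on $\mathbb{C}^n$, and $\Lambda_M$ is cyclic if $\rho(\Lambda_M)=\Lambda_M$. $M$ is $G$-stable if $\tau(M)\subseteq M$ for all $\tau\in G$ (equivalently $\tau(M)=M$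 for all $\tau\in G$). *)

(* Defs.v *)
From HB Require Import structures.
From mathcomp Require Import all_boot all_order all_algebra all_fingroup.
From mathcomp Require Import all_solvable all_field.
From mathcomp Require Import classical_sets reals complex.

Set Implicit Arguments.
Unset Strict Implicit.
Unset Printing Implicit Defensive.

Import GRing.Theory.
Local Open Scope ring_scope.
Local Open Scope classical_set_scope.

Section Modules.
Variables (n : nat) (L : splittingFieldType rat).

Definition Zindependent (b : 'I_n -> L) : Prop :=
  forall c : 'I_n -> int, \sum_(i < n) b i *~ c i = 0 -> forall i, c i = 0.

Definition Zspan (b : 'I_n -> L) : set L :=
  [set x | exists c : 'I_n -> int, x = \sum_(i < n) b i *~ c i].

Definition Zsubmodule_of_rank (M : set L) : Prop :=
  exists b : 'I_n -> L, Zindependent b /\ M = Zspan b.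

End Modules.

Definition cyclic_extension (L : splittingFieldType rat) : Prop :=
  galois 1 {:L} /\ cyclic 'Gal({:L} / 1)%g.

Definition galois_stable (L : splittingFieldType rat) (M : set L) : Prop :=
  forall tau : gal_of {:L}, tau \in 'Gal({:L} / 1)%g -> tau @` M `<=` M.

Section Lattices.
Variables (R : realType) (n : nat) (L : splittingFieldType rat).

Definition minkowski (sigma : 'I_n -> {rmorphism L -> R[i]}) (x : L) :
  'rV[R[i]]_n := \row_(k < n) sigma k x.

(* ord_pred is the cyclic predecessor on 'I_n, so this is
   (c_1, ..., c_n) |-> (c_n, c_1, ..., c_(n-1)). *)
Definition shift (c : 'rV[R[i]]_n) : 'rV[R[i]]_n :=
  \row_(k < n) c ord0 (ord_pred k).

Definition cyclic_lattice (Lambda : set 'rV[R[i]]_n) : Prop :=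
  shift @` Lambda = Lambda.

End Lattices.

(* Main.v *)
(* The ordering of the embeddings makes the shift act on the lattice as theta
   does on K: shift (sigma x) = sigma (theta x).  As sigma is injective, the
   lattice is cyclic iff theta maps M onto itself, and theta generates G. *)
Require Import Defs.
From HB Require Import structures.
From mathcomp Require Import all_boot all_order all_algebra all_fingroup.
From mathcomp Require Import all_solvable all_field.
From mathcomp Require Import classical_sets reals complex.

Set Implicit Arguments.
Unset Strict Implicit.
Unset Printing Implicit Defensive.

Import GRing.Theory.
Local Open Scope ring_scope.
Local Open Scope classical_set_scope.

(** Entry [k] compares the exponents [n - ord_pred k] and [(n - k).+1] of [theta]. They are equal
    for [k > 0]; at [k = 0] they are 1 and [n.+1], which [theta ^+ n = 1] reconciles. *)
Lemma shift_minkowski (R : realType) (n : nat) (K : splittingFieldType rat)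
  (iota : {rmorphism K -> R[i]}) (theta : gal_of {:K})
  (sigma : 'I_n -> {rmorphism K -> R[i]}) :
  (theta ^+ n = 1)%g ->
  (forall (k : 'I_n) (x : K), sigma k x = iota ((theta ^+ (n - k))%g x)) ->
  forall x, shift (minkowski sigma x) = minkowski sigma (theta x).
Proof.
move=> theta_n sigmaE x; apply/rowP => k; rewrite !mxE !sigmaE; congr (iota _).
(* [galM] composes from left to right, so the inner [theta] becomes the left factor. *)
rewrite -galM ?memvf // -expgS.
case: n k theta_n {sigma sigmaE} => [|n] [[|k] lt_kn] //= theta_n.
  (* The wrap-around entry: the predecessor of 0 is the last index. *)
  by rewrite subn0 expgS theta_n mulg1 modn_small // subSnn.
by rewrite modnDr modn_small ?(ltnW lt_kn) // subSS subSn // -ltnS ltnW.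
Qed.

Lemma minkowski_inj (R : realType) (n : nat) (K : splittingFieldType rat)
  (sigma : 'I_n -> {rmorphism K -> R[i]}) :
  (0 < n)%N -> injective (minkowski sigma).
Proof.
by move=> n_gt0 x y /rowP/(_ (Ordinal n_gt0)); rewrite !mxE => /fmorph_inj.
Qed.

(** Reduces stability under the whole group to stability under its generator: in a finite cyclic
    group every element is a natural power. *)
Lemma gal_expg_stable (K : splittingFieldType rat) (theta : gal_of {:K})
  (M : set K) (m : nat) :
  (forall x, M x -> M (theta x)) -> forall x, M x -> M ((theta ^+ m)%g x).
Proof.
move=> thetaM x Mx; elim: m => [|m IHm]; first by rewrite expg0 gal_id.
by rewrite expgSr galM ?memvf //; apply: thetaM.
Qed.

Theorem theorem2 (R : realType) (n : nat) (K : splittingFieldType rat)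
  (hK : cyclic_extension K) (hn : \dim {:K} = n)
  (iota : {rmorphism K -> R[i]})
  (theta : gal_of {:K}) (htheta : generator 'Gal({:K} / 1)%g theta)
  (sigma : 'I_n -> {rmorphism K -> R[i]})
  (hsigma : forall (k : 'I_n) (x : K),
     sigma k x = iota ((theta ^+ (n - k))%g x))
  (M : set K) (hM : Zsubmodule_of_rank n M) :
  cyclic_lattice (minkowski sigma @` M) <-> galois_stable M.
Proof.
have [galK _] := hK; have /eqP genE := htheta.
have order_theta : #[theta]%g = n.
  by rewrite orderE -genE -(galois_dim galK) dimv1 divn1.
have n_gt0 : (0 < n)%N by rewrite -order_theta order_gt0.
have theta_n : (theta ^+ n = 1)%g by rewrite -order_theta expg_order.
have shiftE := shift_minkowski theta_n hsigma.
have sigma_inj := minkowski_inj (sigma := sigma) n_gt0.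
split=> [cycM tau | stabM].
  rewrite genE => /cycleP[m ->] _ [x Mx <-].
  apply: gal_expg_stable Mx => {}x Mx.
  (* The image of [theta x] is the shift of a lattice point; injectivity then brings membership back
     from the lattice to [M]. *)
  have : (minkowski sigma @` M) (minkowski sigma (theta x)).
    by rewrite -cycM -shiftE; exists (minkowski sigma x) => //; exists x.
  by case=> y My /sigma_inj <-.
have theta_gal : theta \in 'Gal({:K} / 1)%g by rewrite genE cycle_id.
apply/seteqP; split=> [_ [_ [x Mx <-] <-] | _ [x Mx <-]].
  rewrite shiftE; exists (theta x) => //.
  by apply: (stabM theta) => //; exists x.
(* Surjectivity of the shift: the preimage comes from [theta^-1], which also lies in the Galois
   group and so preserves [M]. *)
exists (minkowski sigma (theta^-1%g x)).
  exists (theta^-1%g x) => //.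
  by apply: (stabM theta^-1%g); rewrite ?groupV //; exists x.
by rewrite shiftE -galM ?memvf // mulVg gal_id.
Qed.
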